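(* Let $A_\mu\in\mathbb{R}^{n\times n}$ be an invertible matrix (not necessarily symmetric), let $\Omega\in\mathbb{R}^{n\times l}$ be a test matrix, and let $\Pi$ be the orthogonal projector onto $\mathrm{range}(A_\mu\Omega)$. Let $\rho>0$ be a user-specified parameter, take $$\tau=\rho^{1/2}\,\|(I-\Pi)A_\mu\|\,\|A_\mu^{-1}\Pi A_\mu\|^{-1},$$ and let $$P=(I-\Pi)+\tau\left((A_\mu^{-1}\Pi)^{\mathrm T}A_\mu^{-1}\Pi\right)^{1/2}.$$ Then the singular values of the preconditioned operator $PA_\mu$ satisfy $$\left(\|(I-\Pi)A_\mu^{-1}\|^2+\tau^{-2}\right)^{-1}\le\sigma_i(PA_\mu)^2\le(1+\rho)\|(I-\Pi)A_\mu\|^2 .$$ This in particular results in the condition number bounds $$\mathrm{cond}(PA_\mu)^2\le(1+\rho)\frac{\|(I-\Pi)A_\mu\|^2}{\sigma_{\min}(A_\mu)^2}+(1+\rho^{-1})\|A_\mu^{-1}\Pi A_\mu\|^2\le(1+\rho)\left(\frac{\|(I-\Pi)A_\mu\|}{\sigma_{\min}(A_\mu)}\right)^2+(1+\rho^{-1})\left(1+\frac{\|(I-\Pi)A_\mu\|}{\sigma_{\min}(A_\mu)}\right)^2 .$$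
   Context: $\|\cdot\|$ is the spectral norm, $\sigma_i$ denotes the $i$-th singular value and $\sigma_{\min}$ the smallest one, $M^{1/2}$ is the positive semidefinite square root, and $\mathrm{cond}(B)$ is the ratio of the largest to the smallest singular value of $B$. Here $A_\mu=A+\mu I$ with $A\in\mathbb{R}^{n\times n}$ and $\mu\in\mathbb R$, and $l\ll n$.
   Formalization: The lower bound uses ‖A_μ^{-1}(I−Π)‖ in place of the printed ‖(I−Π)A_μ^{-1}‖; the printed form fails for nonsymmetric A_μ, e.g. A_μ=[1 −1; 0 1], Ω=e_1, ρ=2 (P=I, bound 0.5 > σ_min²≈0.382), and the two agree for symmetric A_μ. *)

(* Defs.v *)
From HB Require Import structures.
From mathcomp Require Import all_boot all_order all_algebra.
From mathcomp Require Import polyrcf.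
From mathcomp Require Import boolp classical_sets reals.

Set Implicit Arguments.
Unset Strict Implicit.
Unset Printing Implicit Defensive.

Import Order.TTheory GRing.Theory Num.Theory.

Local Open Scope ring_scope.
Local Open Scope classical_set_scope.

Definition norm2 (R : realType) (n : nat) (x : 'cV[R]_n) : R :=
  Num.sqrt (\sum_i x i 0 ^+ 2).

Definition spectral_norm (R : realType) (m n : nat) (M : 'M[R]_(m, n)) : R :=
  sup [set norm2 (M *m x) | x in [set x : 'cV[R]_n | norm2 x <= 1]].

(* The square roots of the eigenvalues of M^T M, repeated according to their
   multiplicity. [rootsR] lists the distinct real roots in increasing order,
   hence the [rev]: as usual, singular values are in decreasing order. *)
Definition singular_values (R : realType) (n : nat) (M : 'M[R]_n) : seq R :=
  let p := char_poly (M^T *m M) in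
  rev (flatten [seq nseq (mup x p) (Num.sqrt x) | x <- rootsR p]).

(* Indexed from 0: [singular_value M 0] is the largest singular value. *)
Definition singular_value (R : realType) (n : nat) (M : 'M[R]_n) (i : 'I_n) : R :=
  nth 0 (singular_values M) i.

Definition sigma_max (R : realType) (n : nat) (M : 'M[R]_n) : R :=
  head 0 (singular_values M).

Definition sigma_min (R : realType) (n : nat) (M : 'M[R]_n) : R :=
  last 0 (singular_values M).

Definition cond (R : realType) (n : nat) (M : 'M[R]_n) : R :=
  sigma_max M / sigma_min M.

Definition psdmx (R : realType) (n : nat) (M : 'M[R]_n) : Prop :=
  M^T = M /\ forall x : 'cV[R]_n, 0 <= (x^T *m M *m x) 0 0.

(* The default value 0 is only taken when M is not positive semidefinite. *)
Definition psd_sqrt (R : realType) (n : nat) (M : 'M[R]_n) : 'M[R]_n :=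
  xget 0 [set S : 'M[R]_n | psdmx S /\ S *m S = M].

(* Pi is the orthogonal projector onto range(X). The range of X is its column
   space, whereas (_ == _)%MS compares row spaces, hence the transpositions. *)
Definition orth_projector (R : realType) (n l : nat)
    (Pi : 'M[R]_n) (X : 'M[R]_(n, l)) : Prop :=
  [/\ Pi^T = Pi, Pi *m Pi = Pi & (Pi^T == X^T)%MS].

(* Main.v *)
Require Import Defs.
From mathcomp Require Import all_boot all_order all_algebra.
From mathcomp Require Import sesquilinear spectral complex polyrcf.
From mathcomp Require Import ring lra.
From mathcomp Require Import boolp classical_sets reals.

(* Write B for A_mu, Q = I - Pi and X = B^-1 Pi. The root S of X^T X satisfies
   |S y| = |X y|, hence S Q = 0 and, S being symmetric, Q S = 0. So Q and S have
   orthogonal ranges and |P B x|^2 = |Q B x|^2 + tau^2 |X B x|^2, which gives the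
   upper bound. For the lower one, x = (B^-1 Q) (Q B x) + X B x and Cauchy-Schwarz
   yield |x|^2 <= (|B^-1 Q|^2 + tau^-2) |P B x|^2. These estimates are tested on
   eigenvectors of (P B)^T (P B); that there are enough of them, and that the root
   exists, comes from the spectral theorem, stated for the quadratic forms of the
   polynomials in a real symmetric matrix. *)

Set Implicit Arguments.
Unset Strict Implicit.
Unset Printing Implicit Defensive.

Import Order.TTheory GRing.Theory Num.Theory.

Local Open Scope ring_scope.

(** * Spectral theorem for real symmetric matrices *)

Lemma char_poly_conjV (F : fieldType) (n : nat) (V D : 'M[F]_n) :
  V \in unitmx -> char_poly (invmx V *m D *m V) = char_poly D.
Proof.
move=> uV; rewrite /char_poly /char_poly_mx.
have -> : 'X%:M - map_mx polyC (invmx V *m D *m V) =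
    map_mx polyC (invmx V) *m ('X%:M - map_mx polyC D) *m map_mx polyC V.
  rewrite mulmxBr mulmxBl !map_mxM; congr (_ - _).
  by rewrite scalar_mxC -mulmxA -map_mxM mulVmx // map_mx1 mulmx1.
by rewrite !det_mulmx mulrAC -det_mulmx -map_mxM mulVmx // map_mx1 det1 mul1r.
Qed.

(* The weights are |(U y)_i|^2 for a complex unitary U that diagonalizes M. *)
Lemma real_spectral_theorem (R : rcfType) (n : nat) (M : 'M[R]_n.+1) :
  M^T = M ->
  exists d : 'I_n.+1 -> R,
    char_poly M = \prod_i ('X - (d i)%:P) /\
    forall y : 'cV[R]_n.+1, exists w : 'I_n.+1 -> R,
      (forall i, 0 <= w i) /\
      forall p, (y^T *m horner_mx M p *m y) 0 0 = \sum_i p.[d i] * w i.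
Proof.
move=> Msym; pose toC := real_complex R.
have Mherm : map_mx toC M \is hermsymmx.
  apply: realsym_hermsym.
    by apply/is_hermitianmxP; rewrite expr0 scale1r map_mx_id // map_trmx Msym.
  by apply/mxOverP => i j; rewrite mxE; apply/CrealP; rewrite /toC; exact: conjc_real.
have /orthomx_spectralP Mdiag := hermitian_normalmx Mherm.
have Dreal := hermitian_spectral_diag_real Mherm.
have Uunit := spectral_unitarymx (map_mx toC M).
move: Mdiag Dreal Uunit.
move: (spectralmx _) (spectral_diag _) => U D Mdiag Dreal Uunit.
pose d i := complex.Re (D 0 i).
have dE i : D 0 i = toC (d i).
  have /mxOverP/(_ 0 i)/CrealP := Dreal.
  rewrite /d /toC; case: (D 0 i) => a b /= [] bb.
  by have -> : b = 0 by lra.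
exists d; split.
  apply: (map_poly_inj toC); rewrite map_char_poly Mdiag.
  rewrite char_poly_conjV ?unitarymx_unit //.
  rewrite char_poly_trig ?diag_mx_is_trig // rmorph_prod.
  by apply: eq_bigr => i _ /=; rewrite map_polyXsubC mxE eqxx mulr1n dE.
move=> y; pose u := U *m map_mx toC y.
exists (fun i => complex.Re (u i 0) ^+ 2 + complex.Im (u i 0) ^+ 2); split.
  by move=> i; rewrite addr_ge0 ?sqr_ge0.
move=> p; apply: (@complexI R).
transitivity ((map_mx toC (y^T *m horner_mx M p *m y)) 0 0).
  by rewrite [RHS]mxE.
rewrite !map_mxM /= map_horner_mx Mdiag horner_mx_uconjC; last exact: unitarymx_unit.
rewrite horner_mx_diag invmx_unitary // !mulmxA -mulmxA -/u.
(* Conjugation fixes the real vector [y], so the left factor is the conjugate transpose of [u]. *)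
have -> : (map_mx toC y^T) *m (U ^t*)%sesqui = (u ^t*)%sesqui.
  rewrite /u trmx_mul map_mxM; congr (_ *m _).
  by apply/matrixP => i j; rewrite !mxE; symmetry; exact: conjc_real.
clearbody u.
rewrite mxE raddf_sum; apply: eq_bigr => i _ /=.
rewrite mul_mx_diag !mxE dE horner_map /=.
move: (p.[d i] : R) => e; case: (u i 0) => a b.
by simpc; congr Complex; rewrite /=; ring.
Qed.

(** * Euclidean norm and spectral norm *)

Lemma norm2_ge0 (R : realType) (n : nat) (x : 'cV[R]_n) : 0 <= norm2 x.
Proof. exact: sqrtr_ge0. Qed.

Lemma norm2_sqr (R : realType) (n : nat) (x : 'cV[R]_n) :
  norm2 x ^+ 2 = (x^T *m x) 0 0.
Proof.
rewrite sqr_sqrtr; last by apply: sumr_ge0 => i _; exact: sqr_ge0.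
by rewrite mxE; apply: eq_bigr => i _; rewrite mxE expr2.
Qed.

Lemma norm2_eq0 (R : realType) (n : nat) (x : 'cV[R]_n) :
  (norm2 x == 0) = (x == 0).
Proof.
apply/eqP/eqP => [x0|->]; last first.
  by rewrite /norm2 big1 ?sqrtr0 // => i _; rewrite mxE expr0n.
have: norm2 x ^+ 2 == 0 by rewrite x0 expr0n.
rewrite sqr_sqrtr; last by apply: sumr_ge0 => i _; exact: sqr_ge0.
rewrite psumr_eq0 => [/allP xi0|i _]; last exact: sqr_ge0.
apply/matrixP => i j; rewrite ord1 mxE.
by apply/eqP; have := xi0 i (mem_index_enum i); rewrite sqrf_eq0.
Qed.

Lemma norm2_0 (R : realType) (n : nat) : norm2 (0 : 'cV[R]_n) = 0.
Proof. by apply/eqP; rewrite norm2_eq0. Qed.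

Lemma norm2Z (R : realType) (n : nat) (a : R) (x : 'cV[R]_n) :
  norm2 (a *: x) = `|a| * norm2 x.
Proof.
rewrite /norm2 -sqrtr_sqr -sqrtrM ?sqr_ge0 // mulr_sumr; congr Num.sqrt.
by apply: eq_bigr => i _; rewrite mxE exprMn.
Qed.

Lemma norm2D_sqr (R : realType) (n : nat) (x y : 'cV[R]_n) :
  norm2 (x + y) ^+ 2 = norm2 x ^+ 2 + (x^T *m y) 0 0 *+ 2 + norm2 y ^+ 2.
Proof.
rewrite !norm2_sqr !mxE -sumrMnl -!big_split.
by apply: eq_bigr => i _; rewrite !mxE /=; ring.
Qed.

(** Cauchy-Schwarz: with a = |x| and b = |y|, the square |b x - a y|^2 equals 2ab(ab - x^T y), and
    ab > 0 once both vectors are nonzero. *)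
Lemma dot_le_norm2 (R : realType) (n : nat) (x y : 'cV[R]_n) :
  (x^T *m y) 0 0 <= norm2 x * norm2 y.
Proof.
have [->|y0] := eqVneq y 0; first by rewrite mulmx0 mxE norm2_0 mulr0.
have [->|x0] := eqVneq x 0; first by rewrite trmx0 mul0mx mxE norm2_0 mul0r.
have: 0 <= norm2 (norm2 y *: x + - norm2 x *: y) ^+ 2 by rewrite sqr_ge0.
rewrite norm2D_sqr !norm2Z normrN !ger0_norm ?norm2_ge0 //.
have -> : ((norm2 y *: x)^T *m (- norm2 x *: y)) 0 0 =
    - (norm2 x * norm2 y) * (x^T *m y) 0 0.
  by rewrite !mxE mulr_sumr; apply: eq_bigr => i _; rewrite !mxE; ring.
have: 0 < norm2 x * norm2 y.
  by rewrite mulr_gt0 // lt_def norm2_ge0 norm2_eq0 ?x0 ?y0.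
set a := norm2 x; set b := norm2 y; set e := (_ *m _) 0 0 => ab h.
rewrite -subr_ge0 -(pmulr_rge0 _ ab) -(pmulr_rge0 _ (ltr0Sn R 1)).
by apply: le_trans h _; rewrite le_eqVlt; apply/orP; left; apply/eqP; ring.
Qed.

Lemma norm2D (R : realType) (n : nat) (x y : 'cV[R]_n) :
  norm2 (x + y) <= norm2 x + norm2 y.
Proof.
rewrite -ler_sqr ?nnegrE ?addr_ge0 ?norm2_ge0 // norm2D_sqr sqrrD.
by rewrite lerD2r lerD2l lerMn2r dot_le_norm2.
Qed.

(** This makes the supremum in [spectral_norm] a genuine one. The sum of the column norms serves as
    bound, since |x_j| <= |x|. *)
Lemma norm2_mulmx_bounded (R : realType) (m n : nat) (M : 'M[R]_(m, n)) :
  exists2 K, 0 <= K & forall x, norm2 (M *m x) <= K * norm2 x.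
Proof.
exists (\sum_j norm2 (col j M)); first by apply: sumr_ge0 => j _; exact: norm2_ge0.
move=> x; have -> : M *m x = \sum_j x j 0 *: col j M.
  apply/matrixP => i k; rewrite !mxE summxE; apply: eq_bigr => j _.
  by rewrite !mxE ord1 mulrC.
rewrite mulr_suml; apply: (big_rec2 (fun u v => norm2 u <= v)) => [|j u v _ uv].
  by rewrite norm2_0.
apply: le_trans (norm2D _ _) _; apply: lerD => //; rewrite norm2Z mulrC.
rewrite ler_wpM2l ?norm2_ge0 // -sqrtr_sqr ler_wsqrtr //.
by rewrite (bigD1 j) //= lerDl sumr_ge0 // => i _; exact: sqr_ge0.
Qed.

Lemma spectral_norm_ub (R : realType) (m n : nat) (M : 'M[R]_(m, n)) x :
  norm2 x <= 1 -> norm2 (M *m x) <= spectral_norm M.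
Proof.
move=> x1; apply: ub_le_sup; last by exists x.
have [K K0 MK] := norm2_mulmx_bounded M.
exists K => _ [y /= y1 <-]; apply: le_trans (MK y) _.
by rewrite -[leRHS]mulr1 ler_wpM2l.
Qed.

Lemma norm2_mulmx_le (R : realType) (m n : nat) (M : 'M[R]_(m, n)) x :
  norm2 (M *m x) <= spectral_norm M * norm2 x.
Proof.
have [->|x0] := eqVneq x 0; first by rewrite mulmx0 !norm2_0 mulr0.
have x_gt0 : 0 < norm2 x by rewrite lt_def norm2_ge0 norm2_eq0 x0.
rewrite -ler_pdivrMr // mulrC -[_^-1]ger0_norm ?invr_ge0 ?norm2_ge0 //.
rewrite -norm2Z scalemxAr spectral_norm_ub // norm2Z.
by rewrite ger0_norm ?invr_ge0 ?norm2_ge0 // mulVf ?gt_eqF.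
Qed.

Lemma spectral_norm_le (R : realType) (m n : nat) (M : 'M[R]_(m, n)) K :
  0 <= K -> (forall x, norm2 (M *m x) <= K * norm2 x) -> spectral_norm M <= K.
Proof.
move=> K0 MK; apply: ge_sup.
  by exists (norm2 (M *m 0)), 0 => //=; rewrite norm2_0 ler01.
move=> _ [x /= x1 <-]; apply: le_trans (MK x) _.
by rewrite -[leRHS]mulr1 ler_wpM2l.
Qed.

Lemma spectral_norm_ge0 (R : realType) (m n : nat) (M : 'M[R]_(m, n)) :
  0 <= spectral_norm M.
Proof.
have := @spectral_norm_ub _ _ _ M 0; rewrite mulmx0 !norm2_0; apply; exact: ler01.
Qed.

Lemma spectral_norm0_mulmx (R : realType) (m n : nat) (M : 'M[R]_(m, n))
    (x : 'cV[R]_n) :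
  spectral_norm M = 0 -> M *m x = 0.
Proof.
move=> M0; apply/eqP; rewrite -norm2_eq0 eq_le norm2_ge0 andbT.
by rewrite (le_trans (norm2_mulmx_le M x)) // M0 mul0r.
Qed.

(** * Square roots of positive semidefinite matrices *)

Lemma exists_interpolation (F : fieldType) (s : seq F) (f : F -> F) :
  exists p : {poly F}, {in s, forall x, p.[x] = f x}.
Proof.
elim: s => [|x s [p pf]]; first by exists 0.
have [xs|xs] := boolP (x \in s).
  by exists p => y; rewrite inE => /orP[/eqP ->|]; exact: pf.
pose q : {poly F} := \prod_(y <- s) ('X - y%:P).
(* [q] vanishes on [s] but not at the new point, so adding a multiple of it corrects the value at
   [x] and keeps the others. *)
have qx : q.[x] != 0 by rewrite -/(root q x) root_prod_XsubC.
exists (p + ((f x - p.[x]) / q.[x]) *: q) => y; rewrite inE !hornerE.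
case: eqVneq => [->|/= _ ys]; first by rewrite divfK // addrC subrK.
have -> : q.[y] = 0 by apply/eqP; rewrite -/(root q y) root_prod_XsubC.
by rewrite mulr0 addr0 pf.
Qed.

Lemma mulmx_cV_eq0 (R : pzRingType) (m n : nat) (M : 'M[R]_(m, n)) :
  (forall x : 'cV_n, M *m x = 0) -> M = 0.
Proof.
move=> M0; apply/matrixP => i j.
by have /matrixP/(_ i 0) := M0 (delta_mx j 0); rewrite -colE !mxE.
Qed.

(** [eigenvalue] speaks of row vectors; by symmetry the transpose of such a row is a column
    eigenvector. *)
Lemma sym_eigenvector (F : fieldType) (n : nat) (M : 'M[F]_n) (a : F) :
  M^T = M -> root (char_poly M) a -> exists2 v : 'cV_n, v != 0 & M *m v = a *: v.
Proof.
move=> Msym; rewrite -eigenvalue_root_char => /eigenvalueP [v Mv v0].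
exists v^T; first by rewrite -(trmx0 _ _ _) (inj_eq trmx_inj).
by rewrite -{1}Msym -trmx_mul Mv linearZ.
Qed.

Lemma horner_mx_sym (R : comNzRingType) (n : nat) (M : 'M[R]_n.+1) p :
  M^T = M -> (horner_mx M p)^T = horner_mx M p.
Proof.
move=> Msym; elim/poly_ind: p => [|p c IHp]; first by rewrite rmorph0 trmx0.
rewrite rmorphD rmorphM /= horner_mx_X horner_mx_C linearD /= trmx_mul IHp Msym.
by rewrite tr_scalar_mx; congr (_ + _); exact: (comm_mx_horner p (erefl (M *m M))).
Qed.

Lemma psd_gram (R : realType) (m n : nat) (M : 'M[R]_(m, n)) : psdmx (M^T *m M).
Proof.
split=> [|x]; first by rewrite trmx_mul trmxK.
by rewrite mulmxA -trmx_mul -mulmxA -norm2_sqr sqr_ge0.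
Qed.

Lemma psd_eigenvalue_ge0 (R : realType) (n : nat) (M : 'M[R]_n) (a : R) :
  psdmx M -> root (char_poly M) a -> 0 <= a.
Proof.
move=> [Msym Mpos] /(sym_eigenvector Msym) [v v0 Mv].
have := Mpos v; rewrite -mulmxA Mv -scalemxAr mxE -norm2_sqr pmulr_lge0 //.
by rewrite exprn_gt0 // lt_def norm2_ge0 norm2_eq0 v0.
Qed.

(** The root is a polynomial in [M]: [q] takes the fourth roots of the eigenvalues and T = q(M), so
    that T^2 = T^T T is positive semidefinite as a Gram matrix. T^4 - M is a polynomial in [M]
    vanishing at all eigenvalues. *)
Lemma psd_sqrt_exists (R : realType) (n : nat) (M : 'M[R]_n) :
  psdmx M -> exists S, psdmx S /\ S *m S = M.
Proof.
case: n M => [|n] M Mpsd.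
  exists 0; rewrite mulmx0 (flatmx0 M); split=> //; split=> [|x]; first by rewrite trmx0.
  by rewrite mulmx0 mul0mx mxE.
have [Msym _] := Mpsd.
have [d [charM quadM]] := real_spectral_theorem Msym.
have d0 i : 0 <= d i.
  apply: (psd_eigenvalue_ge0 Mpsd); rewrite charM (bigD1 i) //=.
  by rewrite rootM root_XsubC eqxx.
have [q qE] := exists_interpolation (codom d) (fun x => Num.sqrt (Num.sqrt x)).
have {}qE i : q.[d i] ^+ 2 = Num.sqrt (d i).
  by rewrite qE ?codom_f // sqr_sqrtr ?sqrtr_ge0.
pose T := horner_mx M q; have Tsym : T^T = T by exact: horner_mx_sym.
exists (T *m T); split; first by have := psd_gram T; rewrite Tsym.
have TE : T *m T *m (T *m T) - M = horner_mx M (q ^+ 4 - 'X).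
  by rewrite rmorphB /= rmorphXn /= horner_mx_X !exprS expr0 mulr1 -!mulmxE !mulmxA.
apply/eqP; rewrite -subr_eq0 TE; apply/eqP/mulmx_cV_eq0 => y.
(* For Z = T^4 - M, which is symmetric, |Z y|^2 is the quadratic form of Z^2 at [y], to which
   [quadM] applies. *)
apply/eqP; rewrite -norm2_eq0 -sqrf_eq0 norm2_sqr trmx_mul horner_mx_sym //.
rewrite mulmxA -[_ *m _ *m horner_mx _ _]mulmxA mulmxE -rmorphM /=.
have [w [_ ->]] := quadM y; rewrite big1 // => i _.
by rewrite !hornerE -[4%N]/(2 * 2)%N exprM qE sqr_sqrtr // subrr !mul0r.
Qed.

Lemma psd_sqrtP (R : realType) (n : nat) (M : 'M[R]_n) :
  psdmx M -> psdmx (psd_sqrt M) /\ psd_sqrt M *m psd_sqrt M = M.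
Proof.
move=> /psd_sqrt_exists [S SM].
exact: (@xgetI _ 0 [set S | psdmx S /\ S *m S = M]%classic S SM).
Qed.

(** * Singular values and their extremal properties *)

Lemma mem_rootsR (R : rcfType) (p : {poly R}) x :
  p != 0 -> (x \in rootsR p) = root p x.
Proof. by move=> p0; have := roots_on_rootsR p0 x; rewrite inE /= => ->. Qed.

Lemma mup_prod_XsubC (F : fieldType) (I : Type) (r : seq I) (d : I -> F) x :
  mup x (\prod_(i <- r) ('X - (d i)%:P)) = (\sum_(i <- r) (d i == x))%N.
Proof.
elim: r => [|i r IHr]; first by rewrite !big_nil mupNroot // root1.
rewrite !big_cons mupM ?IHr ?polyXsubC_eq0 //; last first.
  by rewrite prodf_seq_neq0; elim: (r) => //= j s ->; rewrite polyXsubC_eq0.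
by congr (_ + _)%N; have := mup_XsubCX 1 x (d i); rewrite expr1 => ->; case: eqP.
Qed.

Lemma char_poly_neq0 (R : nzRingType) (n : nat) (M : 'M[R]_n) : char_poly M != 0.
Proof. exact: monic_neq0 (char_poly_monic M). Qed.

Lemma mem_singular_valuesP (R : realType) (n : nat) (M : 'M[R]_n) s :
  reflect (exists2 x, root (char_poly (M^T *m M)) x & s = Num.sqrt x)
          (s \in singular_values M).
Proof.
have p0 := char_poly_neq0 (M^T *m M).
rewrite mem_rev; apply: (iffP flatten_mapP) => [[x] | [x px ->]].
  by rewrite mem_rootsR // mem_nseq => px /andP[_ /eqP ->]; exists x.
exists x; rewrite ?mem_rootsR // mem_nseq eqxx andbT.
by rewrite -XsubC_dvd // dvdp_XsubCl.
Qed.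

(** All roots of the characteristic polynomial are real, so their multiplicities add up to [n]. For
    [n > 0], the defaults of [head] and [last] are therefore never taken. *)
Lemma size_singular_values (R : realType) (n : nat) (M : 'M[R]_n) :
  size (singular_values M) = n.
Proof.
case: n M => [|n] M.
  rewrite /singular_values /char_poly det_mx00 -[1]/(1%:P) rootsRC //.
have [d [charM _]] := real_spectral_theorem (proj1 (psd_gram M)).
have d_root i : d i \in rootsR (char_poly (M^T *m M)).
  by rewrite mem_rootsR ?char_poly_neq0 // charM (bigD1 i) //= rootM root_XsubC eqxx.
rewrite /singular_values size_rev size_flatten /shape -map_comp sumnE big_map.
under eq_bigr => x _ do rewrite /= size_nseq {1}charM mup_prod_XsubC.
(* Double counting: each [d i] equals exactly one entry of the duplicate-free list [rootsR]. *)
rewrite exchange_big /= (eq_bigr (fun=> 1%N)) ?sum1_card ?card_ord // => i _.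
under eq_bigr => x _ do rewrite eq_sym.
rewrite -big_mkcond /= sum1_count -/(count_mem _ _) count_uniq_mem ?d_root //.
exact: uniq_roots.
Qed.

(** If M^T M v = x v, then |M v|^2 = v^T M^T M v = x |v|^2. Norm estimates on vectors thereby turn
    into bounds on singular values. *)
Lemma singular_vector (R : realType) (n : nat) (M : 'M[R]_n) s :
  s \in singular_values M ->
  0 <= s /\ exists2 v : 'cV_n, 0 < norm2 v & norm2 (M *m v) = s * norm2 v.
Proof.
move=> /mem_singular_valuesP [x px ->]; split; first exact: sqrtr_ge0.
have x0 := psd_eigenvalue_ge0 (psd_gram M) px.
have [v v0 Mv] := sym_eigenvector (proj1 (psd_gram M)) px.
exists v; first by rewrite lt_def norm2_ge0 norm2_eq0 v0.
apply/eqP; rewrite -(@eqrXn2 _ 2) // ?mulr_ge0 ?sqrtr_ge0 ?norm2_ge0 //.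
rewrite exprMn (sqr_sqrtr x0) !norm2_sqr trmx_mul -mulmxA [M^T *m _]mulmxA Mv.
by rewrite -scalemxAr mxE.
Qed.

Lemma sigma_min_le (R : realType) (n : nat) (M : 'M[R]_n) s :
  s \in singular_values M -> sigma_min M <= s.
Proof.
have p0 := char_poly_neq0 (M^T *m M).
move=> /mem_singular_valuesP [x]; rewrite -mem_rootsR // => px ->.
rewrite /sigma_min /singular_values.
have := sorted_roots (- cauchy_bound (char_poly (M^T *m M)))
  (cauchy_bound (char_poly (M^T *m M))) (char_poly (M^T *m M)).
rewrite -/(rootsR _); case E: (rootsR _) px => [//|y r] px /=.
rewrite path_sortedE; last exact: lt_trans.
move=> /andP[/allP yr _].
(* The least root [y] has positive multiplicity, so its block is nonempty and its square root comes
   last after the reversal. *)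
have : (0 < mup y (char_poly (M^T *m M)))%N.
  by rewrite -XsubC_dvd // dvdp_XsubCl -mem_rootsR // E mem_head.
case: mup => // k _; rewrite rev_cat /= rev_cons last_cat last_rcons ler_wsqrtr //.
by move: px; rewrite inE => /orP[/eqP -> //|/yr/ltW].
Qed.

Lemma mem_sigma_max (R : realType) (n : nat) (M : 'M[R]_n) :
  (0 < n)%N -> sigma_max M \in singular_values M.
Proof.
rewrite /sigma_max -{1}(size_singular_values M).
by case: singular_values => // s r _; exact: mem_head.
Qed.

Lemma mem_sigma_min (R : realType) (n : nat) (M : 'M[R]_n) :
  (0 < n)%N -> sigma_min M \in singular_values M.
Proof.
rewrite /sigma_min -{1}(size_singular_values M).
by case: singular_values => //= s r _; exact: mem_last.
Qed.

Lemma sigma_min_ge0 (R : realType) (n : nat) (M : 'M[R]_n) : 0 <= sigma_min M.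
Proof.
rewrite /sigma_min; case E: (singular_values M) => [|s r] //=.
by apply: (proj1 (@singular_vector _ _ M _ _)); rewrite E mem_last.
Qed.

(** Taking the polynomials 1 and X in the spectral theorem for M^T M writes |y|^2 and |M y|^2 as
    sums of w_i and d_i w_i, and every d_i is at least the square of [sigma_min M]. *)
Lemma sigma_min_norm2 (R : realType) (n : nat) (M : 'M[R]_n) y :
  sigma_min M * norm2 y <= norm2 (M *m y).
Proof.
case: n M y => [|n] M y; first by rewrite (flatmx0 y) mulmx0 !norm2_0 mulr0.
have [d [charM quadM]] := real_spectral_theorem (proj1 (psd_gram M)).
have [w [w0 wE]] := quadM y.
rewrite -ler_sqr ?nnegrE ?mulr_ge0 ?norm2_ge0 ?sigma_min_ge0 // exprMn.
have -> : norm2 y ^+ 2 = \sum_i w i.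
  have := wE 1; rewrite rmorph1 mulmx1 -norm2_sqr => ->.
  by apply: eq_bigr => i _; rewrite hornerE mul1r.
have -> : norm2 (M *m y) ^+ 2 = \sum_i d i * w i.
  rewrite norm2_sqr trmx_mul -mulmxA [M^T *m _]mulmxA mulmxA.
  by have := wE 'X; rewrite horner_mx_X => ->; apply: eq_bigr => i _; rewrite hornerX.
rewrite mulr_sumr; apply: ler_sum => i _; apply: ler_wpM2r => //.
have di : root (char_poly (M^T *m M)) (d i).
  by rewrite charM (bigD1 i) //= rootM root_XsubC eqxx.
rewrite -[leRHS]sqr_sqrtr ?(psd_eigenvalue_ge0 (psd_gram M) di) //.
rewrite ler_sqr ?nnegrE ?sqrtr_ge0 ?sigma_min_ge0 //.
by apply: sigma_min_le; apply/mem_singular_valuesP; exists (d i).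
Qed.

Lemma sigma_min_unitmx (R : realType) (n : nat) (M : 'M[R]_n) :
  (0 < n)%N -> M \in unitmx -> 0 < sigma_min M.
Proof.
move=> n0 Mu; have [s0 [v v0 Mv]] := singular_vector (mem_sigma_min M n0).
rewrite lt_def s0 andbT.
apply: contraTneq v0 => s00; move: Mv.
rewrite s00 mul0r => /eqP; rewrite norm2_eq0 => /eqP Mv0.
by rewrite -(mulKmx Mu v) Mv0 mulmx0 norm2_0 ltxx.
Qed.

(** Apply [sigma_min_norm2] to the vector M^-1 X x. *)
Lemma spectral_norm_invmx_le (R : realType) (n m : nat) (M : 'M[R]_n) (X : 'M[R]_(n, m)) :
  M \in unitmx -> spectral_norm (invmx M *m X) <= spectral_norm X / sigma_min M.
Proof.
move=> Mu; apply: spectral_norm_le.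
  by rewrite divr_ge0 ?spectral_norm_ge0 ?sigma_min_ge0.
case: n M X Mu => [|n] M X Mu x.
  rewrite (flatmx0 (_ *m x)) norm2_0 !mulr_ge0 ?invr_ge0 ?spectral_norm_ge0 //.
    exact: sigma_min_ge0.
  exact: norm2_ge0.
have s0 : 0 < sigma_min M by exact: sigma_min_unitmx.
rewrite mulrAC ler_pdivlMr // mulrC -mulmxA.
apply: le_trans (sigma_min_norm2 _ _) _; rewrite mulKVmx //.
exact: norm2_mulmx_le.
Qed.

(** * Estimates for the preconditioned operator *)

Lemma preconditioner_norm2 (R : realType) (n m : nat) (Pi : 'M[R]_n)
    (X : 'M[R]_(m, n)) (tau : R) (y : 'cV[R]_n) :
  Pi^T = Pi -> Pi *m Pi = Pi ->
  norm2 (((1%:M - Pi) + tau *: psd_sqrt ((X *m Pi)^T *m (X *m Pi))) *m y) ^+ 2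
    = norm2 ((1%:M - Pi) *m y) ^+ 2 + tau ^+ 2 * norm2 (X *m Pi *m y) ^+ 2.
Proof.
move=> PiT PiPi; have [[]] := psd_sqrtP (psd_gram (X *m Pi)).
move: (psd_sqrt _) => S ST _ SS.
have S_norm z : norm2 (S *m z) = norm2 (X *m Pi *m z).
  apply/eqP; rewrite -(@eqrXn2 _ 2) ?norm2_ge0 // !norm2_sqr !trmx_mul.
  by rewrite -!mulmxA [S^T *m _]mulmxA ST SS -!mulmxA trmx_mul -!mulmxA.
(* [S] has the same kernel as [X *m Pi], which kills the range of I - Pi. Transposing gives [QS],
   which removes the cross term of the squared norm. *)
have SQ : S *m (1%:M - Pi) = 0.
  apply: mulmx_cV_eq0 => z; apply/eqP; rewrite -norm2_eq0 -mulmxA S_norm.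
  by rewrite mulmxA -(mulmxA X) mulmxBr mulmx1 PiPi subrr mulmx0 mul0mx norm2_0.
have QS : (1%:M - Pi)^T *m S = 0.
  by rewrite -[LHS]trmxK trmx_mul trmxK ST SQ trmx0.
rewrite mulmxDl norm2D_sqr -scalemxAl norm2Z exprMn real_normK ?num_real //.
rewrite S_norm -scalemxAr trmx_mul -mulmxA (mulmxA _ S) QS.
by rewrite mul0mx mulmx0 scaler0 mxE mul0rn addr0.
Qed.

(** |Q x|^2 = x^T (Q x) <= |x| |Q x|. *)
Lemma norm2_projector_le (R : realType) (n : nat) (Q : 'M[R]_n) (x : 'cV[R]_n) :
  Q^T = Q -> Q *m Q = Q -> norm2 (Q *m x) <= norm2 x.
Proof.
move=> QT QQ; have [->|Qx0] := eqVneq (Q *m x) 0; first by rewrite norm2_0 norm2_ge0.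
have Qx_gt0 : 0 < norm2 (Q *m x) by rewrite lt_def norm2_ge0 norm2_eq0 Qx0.
rewrite -(ler_pM2r Qx_gt0) -expr2 norm2_sqr trmx_mul QT -mulmxA [Q *m _]mulmxA QQ.
exact: dot_le_norm2.
Qed.

(** Cauchy-Schwarz for the pairs (c, 1/t) and (a, t b), through Lagrange's identity. *)
Lemma sqr_add_le (R : realFieldType) (c a t b : R) :
  t != 0 -> (c * a + b) ^+ 2 <= (c ^+ 2 + t ^- 2) * (a ^+ 2 + t ^+ 2 * b ^+ 2).
Proof.
move=> t0; rewrite -subr_ge0.
suff -> : (c ^+ 2 + t ^- 2) * (a ^+ 2 + t ^+ 2 * b ^+ 2) - (c * a + b) ^+ 2 =
  (c * t * b - t^-1 * a) ^+ 2 by exact: sqr_ge0.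
by field.
Qed.

Section Bounds.
Variables (R : realType) (n : nat) (B Pi : 'M[R]_n) (rho : R).
Hypotheses (Bu : B \in unitmx) (PiT : Pi^T = Pi) (PiPi : Pi *m Pi = Pi).
Hypothesis (rho_gt0 : 0 < rho).

Let m := spectral_norm ((1%:M - Pi) *m B).
(** The norm of the oblique projector obtained by conjugating [Pi] with [B]. *)
Let N := spectral_norm (invmx B *m Pi *m B).
Let c := spectral_norm (invmx B *m (1%:M - Pi)).
Let tau := Num.sqrt rho * m * N^-1.
Let P := (1%:M - Pi) + tau *: psd_sqrt ((invmx B *m Pi)^T *m (invmx B *m Pi)).

Let m_ge0 : 0 <= m. Proof. exact: spectral_norm_ge0. Qed.
Let N_ge0 : 0 <= N. Proof. exact: spectral_norm_ge0. Qed.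
Let c_ge0 : 0 <= c. Proof. exact: spectral_norm_ge0. Qed.

Let QQ : (1%:M - Pi) *m (1%:M - Pi) = 1%:M - Pi.
Proof. by rewrite mulmxBr mulmx1 mulmxBl mul1mx PiPi subrr subr0. Qed.

Let tau_sqr : tau ^+ 2 = rho * m ^+ 2 * N ^- 2.
Proof. by rewrite /tau !exprMn exprVn sqr_sqrtr // ltW. Qed.

(** As [rho > 0], [tau] can vanish only with [m] or [N]. The case [m = 0] is treated apart; the
    other alternative is what the lower estimate requires. *)
Let tau_cases : m = 0 \/ (tau != 0 \/ N = 0).
Proof.
have [m0|m0] := eqVneq m 0; first by left.
have [N0|N0] := eqVneq N 0; first by right; right.
by right; left; rewrite !mulf_neq0 ?invr_eq0 // sqrtr_eq0 -ltNge.
Qed.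

Lemma norm2_PB (x : 'cV[R]_n) :
  norm2 (P *m B *m x) ^+ 2 =
  norm2 ((1%:M - Pi) *m B *m x) ^+ 2 + tau ^+ 2 * norm2 (invmx B *m Pi *m B *m x) ^+ 2.
Proof. by rewrite -(mulmxA P) preconditioner_norm2 // !mulmxA. Qed.

Lemma norm2_PB_le (x : 'cV[R]_n) :
  norm2 (P *m B *m x) ^+ 2 <= (1 + rho) * m ^+ 2 * norm2 x ^+ 2.
Proof.
rewrite norm2_PB mulrDl mul1r mulrDl; apply: lerD.
  rewrite -exprMn ler_sqr ?nnegrE ?mulr_ge0 ?norm2_ge0 //.
  exact: norm2_mulmx_le.
(* The identity tau^2 N^2 = rho m^2 relies on N being nonzero; for N = 0 the vector B^-1 Pi B x is
   itself zero. *)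
have [N0|N0] := eqVneq N 0.
  rewrite (spectral_norm0_mulmx _ N0) norm2_0 expr0n mulr0.
  by rewrite mulr_ge0 ?sqr_ge0 // mulr_ge0 ?sqr_ge0 // ltW.
apply: (@le_trans _ _ (tau ^+ 2 * (N * norm2 x) ^+ 2)).
  rewrite ler_wpM2l ?sqr_ge0 // ler_sqr ?nnegrE ?mulr_ge0 ?norm2_ge0 //.
  exact: norm2_mulmx_le.
by rewrite tau_sqr le_eqVlt; apply/orP; left; apply/eqP; field.
Qed.

Lemma norm2_PB_ge (x : 'cV[R]_n) : tau != 0 \/ N = 0 ->
  norm2 x ^+ 2 <= (c ^+ 2 + tau ^- 2) * norm2 (P *m B *m x) ^+ 2.
Proof.
move=> tauN; rewrite norm2_PB.
set a := norm2 (_ *m B *m x); set b := norm2 (_ *m B *m x).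
have xab : norm2 x <= c * a + b.
  have {1}-> : x = invmx B *m (1%:M - Pi) *m ((1%:M - Pi) *m B *m x)
                   + invmx B *m Pi *m B *m x.
    rewrite -!mulmxA -mulmxDr.
    by rewrite (mulmxA (1%:M - Pi) (1%:M - Pi)) QQ -mulmxDl subrK mul1mx mulKmx.
  apply: le_trans (norm2D _ _) _; rewrite lerD2r; exact: norm2_mulmx_le.
apply: (@le_trans _ _ ((c * a + b) ^+ 2)).
  by rewrite ler_sqr ?nnegrE ?addr_ge0 ?mulr_ge0 ?norm2_ge0.
(* If [tau = 0], then [N = 0], so [b] vanishes; [tau ^- 2] is 0 by convention, and the claim becomes
   an equality. *)
have [t0|/sqr_add_le] := eqVneq tau 0; last exact.
have N0 : N = 0 by case: tauN => // /eqP.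
have -> : b = 0 by rewrite /b (spectral_norm0_mulmx _ N0) norm2_0.
by rewrite t0 expr0n /= invr0 mul0r !addr0 exprMn.
Qed.

Lemma singular_value_PB_le s :
  s \in singular_values (P *m B) -> s ^+ 2 <= (1 + rho) * m ^+ 2.
Proof.
move=> /singular_vector [s0 [v v0 sv]].
have := norm2_PB_le v; rewrite sv exprMn ler_pM2r //.
by rewrite exprn_gt0.
Qed.

(** In this form, without an inverse, the estimate also shows that neither factor on the right is
    zero. *)
Lemma singular_value_PB_ge s : tau != 0 \/ N = 0 ->
  s \in singular_values (P *m B) -> 1 <= (c ^+ 2 + tau ^- 2) * s ^+ 2.
Proof.
move=> tauN /singular_vector [s0 [v v0 sv]].
have := norm2_PB_ge v tauN; rewrite sv [(s * _) ^+ 2]exprMn mulrA.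
rewrite -[leLHS]mul1r ler_pM2r //.
by rewrite exprn_gt0.
Qed.

(** [B] is invertible, so (I - Pi) B = 0 forces I - Pi = 0. *)
Let m0_c0 : m = 0 -> c = 0.
Proof.
move=> m0; have Q0 : 1%:M - Pi = 0.
  by rewrite -[LHS](mulmxK Bu) (mulmx_cV_eq0 (fun x => spectral_norm0_mulmx x m0)) mul0mx.
apply/eqP; rewrite eq_le c_ge0 andbT; apply: spectral_norm_le => // x.
by rewrite Q0 mulmx0 mul0mx norm2_0 mul0r.
Qed.

Lemma singular_value_PB_bounds s :
  s \in singular_values (P *m B) ->
  (c ^+ 2 + tau ^- 2)^-1 <= s ^+ 2 <= (1 + rho) * m ^+ 2.
Proof.
move=> sP; rewrite singular_value_PB_le // andbT.
have [m0|tauN] := tau_cases.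
  (* Here [tau] and [c] vanish as well, and the lower bound is the inverse of 0, that is 0. *)
  by rewrite /tau m0 (m0_c0 m0) mulr0 mul0r !expr0n /= invr0 addr0 invr0 sqr_ge0.
have h := singular_value_PB_ge tauN sP.
rewrite -[_^-1]mul1r ler_pdivrMr; first by rewrite mulrC.
rewrite lt_def addr_ge0 ?invr_ge0 ?sqr_ge0 // andbT.
by apply: contraTneq h => ->; rewrite mul0r ler10.
Qed.

Lemma cond_PB_le :
  cond (P *m B) ^+ 2 <=
  (1 + rho) * (m ^+ 2 / sigma_min B ^+ 2) + (1 + rho^-1) * N ^+ 2.
Proof.
have rhs_ge0 : 0 <= (1 + rho) * (m ^+ 2 / sigma_min B ^+ 2) + (1 + rho^-1) * N ^+ 2.
  by rewrite addr_ge0 ?mulr_ge0 ?addr_ge0 ?invr_ge0 ?sqr_ge0 ?ler01 ?(ltW rho_gt0).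
have sizeP := size_singular_values (P *m B).
have [n0|n_gt0] := posnP n.
  by rewrite /cond /sigma_max (size0nil (etrans sizeP n0)) mul0r expr0n.
have maxP := mem_sigma_max (P *m B) n_gt0.
have minP := mem_sigma_min (P *m B) n_gt0.
have smax := singular_value_PB_le maxP.
(* For [m = 0] the upper bound gives a zero largest singular value, hence a zero quotient [cond],
   whatever its denominator. *)
have [m0|m_neq0] := eqVneq m 0.
  have: sigma_max (P *m B) ^+ 2 == 0.
    by rewrite eq_le sqr_ge0 andbT (le_trans smax) // m0 expr0n mulr0.
  by rewrite sqrf_eq0 /cond => /eqP ->; rewrite mul0r expr0n.
have tauN : tau != 0 \/ N = 0.
  by case: tau_cases => // m0; rewrite m0 eqxx in m_neq0.
have smin := singular_value_PB_ge tauN minP.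
(* |B^-1 (I - Pi)| <= |I - Pi| / sigma_min(B), and an orthogonal projector has norm at most 1. *)
have c_le : c <= (sigma_min B)^-1.
  apply: le_trans (spectral_norm_invmx_le _ Bu) _.
  rewrite ler_piMl ?invr_ge0 ?sigma_min_ge0 // spectral_norm_le // => x.
  by rewrite mul1r norm2_projector_le // linearB /= trmx1 PiT.
have smin_gt0 : 0 < sigma_min (P *m B) ^+ 2.
  rewrite lt_def sqr_ge0 andbT; apply: contraTneq smin => ->.
  by rewrite mulr0 ler10.
rewrite /cond expr_div_n ler_pdivrMr //.
apply: le_trans smax _.
apply: (@le_trans _ _
  ((1 + rho) * m ^+ 2 * ((c ^+ 2 + tau ^- 2) * sigma_min (P *m B) ^+ 2))).
  by rewrite ler_peMr // mulr_ge0 ?sqr_ge0 // addr_ge0 // ltW.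
rewrite mulrA ler_wpM2r ?sqr_ge0 // mulrDr; apply: lerD.
  rewrite -mulrA ler_wpM2l ?addr_ge0 ?(ltW rho_gt0) //.
  rewrite ler_wpM2l ?sqr_ge0 // -exprVn ler_sqr ?nnegrE //.
  by rewrite invr_ge0 sigma_min_ge0.
(* (1 + rho) m^2 tau^-2 = (1 + rho) rho^-1 N^2 = (1 + rho^-1) N^2; for N = 0 both sides are 0. *)
rewrite tau_sqr le_eqVlt; apply/orP; left; apply/eqP.
have [->|N0] := eqVneq N 0; first by rewrite expr0n /= invr0 mulr0 invr0 !mulr0.
by field; rewrite N0 m_neq0 gt_eqF.
Qed.

(** Write B^-1 Pi B = I - B^-1 (I - Pi) B and use the triangle inequality. *)
Lemma norm_oblique_le : N <= 1 + m / sigma_min B.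
Proof.
apply: spectral_norm_le.
  by rewrite addr_ge0 // divr_ge0 ?sigma_min_ge0.
move=> x; rewrite mulrDl mul1r.
have -> : invmx B *m Pi *m B *m x = x - invmx B *m ((1%:M - Pi) *m B) *m x.
  by rewrite mulmxBl mul1mx mulmxBr mulVmx // mulmxBl mul1mx opprB addrC subrK mulmxA.
apply: le_trans (norm2D _ _) _; rewrite lerD2l -scaleN1r norm2Z normrN1 mul1r.
apply: le_trans (norm2_mulmx_le _ _) _; rewrite ler_wpM2r ?norm2_ge0 //.
exact: spectral_norm_invmx_le.
Qed.

End Bounds.

(* The first bound uses `|A^-1 (I - Pi)|, in this order of the factors: with
   `|(I - Pi) A^-1| it fails for nonsymmetric A, e.g. for A = [1 -1; 0 1],
   Omega = e1 and rho = 2, where P = I. *)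
Theorem proposition3p4 (R : realType) (n l : nat) (A : 'M[R]_n) (mu : R)
    (Omega : 'M[R]_(n, l)) (Pi : 'M[R]_n) (rho : R) :
  let Amu := A + mu%:M in
  Amu \in unitmx ->
  orth_projector Pi (Amu *m Omega) ->
  0 < rho ->
  let Ainv := invmx Amu in
  let tau := Num.sqrt rho * spectral_norm ((1%:M - Pi) *m Amu)
             * (spectral_norm (Ainv *m Pi *m Amu))^-1 in
  let P := (1%:M - Pi) + tau *: psd_sqrt ((Ainv *m Pi)^T *m (Ainv *m Pi)) in
  [/\ forall i : 'I_n,
        (spectral_norm (Ainv *m (1%:M - Pi)) ^+ 2 + tau ^- 2)^-1
          <= singular_value (P *m Amu) i ^+ 2
          <= (1 + rho) * spectral_norm ((1%:M - Pi) *m Amu) ^+ 2,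
      cond (P *m Amu) ^+ 2
        <= (1 + rho) * (spectral_norm ((1%:M - Pi) *m Amu) ^+ 2
                        / sigma_min Amu ^+ 2)
           + (1 + rho^-1) * spectral_norm (Ainv *m Pi *m Amu) ^+ 2
    & (1 + rho) * (spectral_norm ((1%:M - Pi) *m Amu) ^+ 2
                   / sigma_min Amu ^+ 2)
      + (1 + rho^-1) * spectral_norm (Ainv *m Pi *m Amu) ^+ 2
        <= (1 + rho) * (spectral_norm ((1%:M - Pi) *m Amu)
                        / sigma_min Amu) ^+ 2
           + (1 + rho^-1) * (1 + spectral_norm ((1%:M - Pi) *m Amu)
                                 / sigma_min Amu) ^+ 2].
Proof.
move=> Amu Au [PiT PiPi _] rho_gt0 Ainv tau P; split.
- move=> i; apply: singular_value_PB_bounds => //.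
  (* The list has exactly [n] entries, so [nth] never returns its default. *)
  by rewrite mem_nth // size_singular_values.
- exact: cond_PB_le.
- rewrite expr_div_n lerD2l ler_wpM2l ?addr_ge0 ?invr_ge0 ?(ltW rho_gt0) //.
  rewrite ler_sqr ?nnegrE ?addr_ge0 ?divr_ge0 ?spectral_norm_ge0 ?sigma_min_ge0 //.
  exact: norm_oblique_le.
Qed.
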